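(* Let $\mathbf{g}=(g_1,\ldots,g_m)$ be a vector of polynomials in $\mathbb{R}[\mathbf{x}]$, $\mathbf{x}=(x_1,\ldots,x_n)$, such that $\mathscr{X}=\{\mathbf{x}\in\mathbb{R}^n : g_i(\mathbf{x})\ge 0,\ i=1,\ldots,m\}$ is nonempty and compact. Assume that there is $R>0$, the radius of a Euclidean ball including $\mathscr{X}$, such that $R^2-\sum_{i=1}^n x_i^2\in\mathscr{Q}(\mathbf{g})^r_2$ for all integers $r\ge 1$. Then for every relaxation order $r\ge 1$ and every degree $d\ge 0$, the exactness cone $\mathscr{F}(\mathbf{g})^r_d$ is given by \[ \mathscr{F}(\mathbf{g})^r_d=\bigcup_{\hat{\mathbf{x}}\in\mathscr{X}}\mathscr{S}_{\hat{\mathbf{x}}}(\mathbf{g})^r_d, \] where each cone \[ \mathscr{S}_{\hat{\mathbf{x}}}(\mathbf{g})^r_d:=\{f\in\mathbb{R}[\mathbf{x}]_d : f-f(\hat{\mathbf{x}})\in\mathscr{Q}(\mathbf{g})^r_d\} \] is semidefinite representable.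
   Context: $\mathbb{R}[\mathbf{x}]_d$ is the vector space of real polynomials in $\mathbf{x}=(x_1,\ldots,x_n)$ of degree at most $d$, and $\Sigma[\mathbf{x}]\subset\mathbb{R}[\mathbf{x}]$ is the convex cone of sums of squares of polynomials. For $f\in\mathbb{R}[\mathbf{x}]_d$, $v(f):=\min_{\mathbf{x}\in\mathscr{X}}f(\mathbf{x})$. With $g_0:=1$, the truncated quadratic module is \[ \mathscr{Q}(\mathbf{g})^r_d:=\Big\{p\in\mathbb{R}[\mathbf{x}]_d : p=\sum_{i=0}^m s_i g_i,\ s_i\in\Sigma[\mathbf{x}],\ s_i g_i\in\mathbb{R}[\mathbf{x}]_{2r}\Big\}. \] The exactness cone of degree $d$ at relaxation order $r$ is \[ \mathscr{F}(\mathbf{g})^r_d:=\{f\in\mathbb{R}[\mathbf{x}]_d : f-v(f)\in\mathscr{Q}(\mathbf{g})^r_d\}. \] A set in a finite-dimensional real vector space is semidefinite representable if it is the linear projection of a spectrahedron, i.e. of a linear (affine) section of the cone of positive semidefinite quadratic forms (equivalently, positive semidefinite symmetric matrices). In an expression such as $f-f(\hat{\mathbf{x}})$, the real number $f(\hat{\mathbf{x}})$ is regarded as a constant polynomial. *)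

(* Defs.v *)
From HB Require Import structures.
From mathcomp Require Import all_boot all_order all_algebra.
From mathcomp Require Import all_classical all_reals all_analysis.
(* The notations of mpoly clash with those of MathComp-Analysis; [{mpoly R[n]}]
   is therefore written [mpoly n R], [p.@[v]] is [meval v p], [c%:MP] is
   [mpolyC n c], and ['X_i] is [mpolyX R (mnm1 i)]. *)
From mathcomp Require Import -(notations) mpoly.

Set Implicit Arguments.
Unset Strict Implicit.
Unset Printing Implicit Defensive.

Import Order.TTheory GRing.Theory Num.Theory.
Import numFieldNormedType.Exports.

Local Open Scope classical_set_scope.
Local Open Scope ring_scope.

Section SemidefiniteRepresentability.
Variable R : realType.

Definition psdmx (N : nat) (M : 'M[R]_N) : Prop :=
  M^T = M /\ forall v : 'rV[R]_N, 0 <= (v *m M *m v^T) ord0 ord0.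

(* The section of the cone of positive semidefinite matrices by the affine
   subspace [A + W]. *)
Definition spectrahedron (N : nat) (K : set 'M[R]_N) : Prop :=
  exists (A : 'M[R]_N) (W : {vspace 'M[R]_N}),
    K = [set M | psdmx M /\ M - A \in W].

(* [S] is a subset of the linear subspace [V] of the ambient space [E]; the
   latter need not have finite dimension. The linear map takes values in [V]. *)
Definition semidefinite_representable (E : lmodType R) (V S : set E) : Prop :=
  exists (N : nat) (K : set 'M[R]_N) (pi : {linear 'M[R]_N -> E}),
    [/\ spectrahedron K, range pi `<=` V & S = pi @` K].

Definition is_cone (E : lmodType R) (S : set E) : Prop :=
  forall (t : R) (f : E), 0 <= t -> S f -> S (t *: f).

End SemidefiniteRepresentability.

Section ExactnessCone.
Variables (R : realType) (n : nat).
Local Notation poly := (mpoly n R).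

Definition evalp (f : poly) (x : 'rV[R]_n) : R := meval (fun i => x ord0 i) f.

(* [mpoly.msize f] is the degree of [f] plus one, and [0] for [f = 0]. *)
Definition polys_le (d : nat) : set poly := [set f | (mpoly.msize f <= d.+1)%N].

Definition sos : set poly :=
  [set s | exists qs : seq poly, s = \sum_(q <- qs) q ^+ 2].

Variables (m : nat) (g : 'I_m -> poly).

Definition feasible : set 'rV[R]_n := [set x | forall i, 0 <= evalp (g i) x].

(* [g_0 = 1], and [g_(i+1)] is the [i]-th entry of [g]. *)
Definition gext (i : 'I_m.+1) : poly :=
  if unlift ord0 i is Some j then g j else 1.

Definition quadmod (r d : nat) : set poly :=
  [set p | polys_le d p /\
     exists s : 'I_m.+1 -> poly,
       [/\ forall i, sos (s i),
           forall i, polys_le (2 * r) (s i * gext i)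
         & p = \sum_(i < m.+1) s i * gext i]].

(* The least value of [f] on [feasible]; it is [0] by convention if there is
   none. *)
Definition minval (f : poly) : R :=
  xget 0 [set v | (evalp f @` feasible) v /\ lbound (evalp f @` feasible) v].

Definition exactness_cone (r d : nat) : set poly :=
  [set f | polys_le d f /\ quadmod r d (f - mpolyC n (minval f))].

Definition point_cone (x : 'rV[R]_n) (r d : nat) : set poly :=
  [set f | polys_le d f /\ quadmod r d (f - mpolyC n (evalp f x))].

Definition sqnorm_poly : poly := \sum_(i < n) mpolyX R (mnm1 i) ^+ 2.

End ExactnessCone.

(* Main.v *)
(* If [f - f(x)] lies in the quadratic module for some feasible [x], it is
   nonnegative on the feasible set, so [f(x)] is the minimum of [f]; conversely
   the minimum is attained by compactness. This gives the union.

   A point cone consists of the polynomials [c + q] with [c] a constant and [q]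
   in the truncated quadratic module with [q(x) = 0]. Leading terms of squares
   cannot cancel, so the squared polynomials in a multiplier [s_i] have degree
   at most [r], and the multipliers are read off the diagonal blocks of a single
   positive semidefinite matrix with rows indexed by pairs (i, monomial). The
   degree bounds and [q(x) = 0] are linear in the matrix. *)
Require Import Defs.
From HB Require Import structures.
From mathcomp Require Import all_boot all_order all_algebra ring lra.
From mathcomp Require Import all_classical all_reals all_analysis.
From mathcomp Require Import -(notations) ssrcomplements mpoly.
Import Order.TTheory GRing.Theory Num.Theory.
Import numFieldNormedType.Exports.
Local Open Scope classical_set_scope.
Local Open Scope ring_scope.

(** * Positive semidefinite matrices as sums of rank-one squares *)

Section PsdMatrices.
Context {R : realType} {N : nat}.
Implicit Types (M : 'M[R]_N) (u v w : 'rV[R]_N) (t : R) (i j : 'I_N).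

Local Notation form M u v := ((u *m M *m v^T) ord0 ord0).

Local Notation unit_row i := (delta_mx ord0 i : 'rV[R]_N).

Lemma formBZl M u w v t : form M (u - t *: w) v = form M u v - t * form M w v.
Proof.
have E (A B : 'M[R]_1) : (A - t *: B) ord0 ord0 = A ord0 ord0 - t * B ord0 ord0.
  by rewrite !mxE.
by rewrite -E !mulmxBl -!scalemxAl.
Qed.

Lemma formC M u v : M^T = M -> form M u v = form M v u.
Proof.
move=> sM; have -> : form M v u = (v *m M *m u^T)^T ord0 ord0 by rewrite [RHS]mxE.
by rewrite !trmx_mul sM trmxK mulmxA.
Qed.

Lemma form_delta M v i : form M v (unit_row i) = (v *m M) ord0 i.
Proof.
rewrite trmx_delta.
by have /matrixP/(_ ord0 ord0) := colE i (v *m M); rewrite mxE => ->.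
Qed.

Lemma form_deltas M i j : form M (unit_row i) (unit_row j) = M i j.
Proof. by rewrite form_delta -rowE mxE. Qed.

Lemma form_rank1 u v : form (u^T *m u) v v = (u *m v^T) ord0 ord0 ^+ 2.
Proof.
rewrite mulmxA -mulmxA -[v *m u^T]trmxK trmx_mul trmxK.
by rewrite mxE big_ord1 mxE -expr2.
Qed.

Lemma form_quadBZ M v w t : M^T = M ->
  form M (v - t *: w) (v - t *: w) =
  form M v v - 2 * t * form M v w + t ^+ 2 * form M w w.
Proof.
move=> sM; rewrite formBZl (formC M v) // (formC M w (_ - _)) // !formBZl (formC M w v) //.
by ring.
Qed.

Lemma psdmx_rank1 v : psdmx (v^T *m v).
Proof.
split=> [|w]; first by rewrite trmx_mul trmxK.
by rewrite form_rank1 sqr_ge0.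
Qed.

Lemma psdmxD M1 M2 : psdmx M1 -> psdmx M2 -> psdmx (M1 + M2).
Proof.
move=> [sM1 pM1] [sM2 pM2]; split=> [|v]; first by rewrite linearD/= sM1 sM2.
by rewrite mulmxDr mulmxDl mxE addr_ge0.
Qed.

Lemma psdmx_sum_rank1 (vs : seq 'rV[R]_N) :
  psdmx (\sum_(v <- vs) v^T *m v).
Proof.
elim/big_ind: _ => [|M1 M2|v _]; [|exact: psdmxD|exact: psdmx_rank1].
by split=> [|v]; rewrite ?trmx0 ?mulmx0 ?mul0mx ?mxE.
Qed.

Lemma psdmx_diag_ge0 M i : psdmx M -> 0 <= M i i.
Proof. by case=> _ /(_ (unit_row i)); rewrite form_deltas. Qed.

(** The form of this Schur complement at [v] is the minimum over [t] of the form of [M] at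
    [v - t *: unit_row i]. *)
Lemma psdmx_schur M i : psdmx M -> 0 < M i i ->
  psdmx (M - (M i i)^-1 *: ((row i M)^T *m row i M)).
Proof.
move=> [sM pM] Mi_gt0; split=> [|v].
  by rewrite linearB linearZ/= trmx_mul trmxK sM.
have rowE' : (row i M *m v^T) ord0 ord0 = form M v (unit_row i).
  by rewrite rowE formC.
(* The coefficient is the minimiser of the quadratic in [t]. *)
have := pM (v - (form M v (unit_row i) / M i i) *: unit_row i).
rewrite form_quadBZ // form_deltas => le0.
have E (A B : 'M[R]_1) t : (A - t *: B) ord0 ord0 = A ord0 ord0 - t * B ord0 ord0.
  by rewrite !mxE.
rewrite mulmxBr mulmxBl -scalemxAr -scalemxAl E form_rank1 rowE'.
apply: le_trans le0 _; rewrite le_eqVlt; apply/orP; left; apply/eqP.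
by field; rewrite gt_eqF.
Qed.

(** Induction on the number of nonzero diagonal entries: passing to a Schur complement splits off
    one rank-one term and lowers this number. *)
Lemma psdmx_rank1_decomposition M : psdmx M ->
  exists vs : seq 'rV[R]_N, M = \sum_(v <- vs) v^T *m v.
Proof.
have [k] := ubnP #|[pred i | M i i != 0]|; elim: k M => // k IHk M le_k psdM.
have sM := psdM.1.
have [/existsP[i Mi_neq0]|/existsPn diag0] := boolP [exists i, M i i != 0]; last first.
  exists [::]; rewrite big_nil; apply/matrixP => i j; rewrite mxE.
  have {}diag0 l : M l l = 0 by apply/eqP; rewrite -[_ == _]negbK diag0.
  (* With a zero diagonal the form takes the value [- 2 * M i j ^+ 2] here, which forces
     [M i j = 0]. *)
  have := psdM.2 (unit_row i - M i j *: unit_row j).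
  rewrite form_quadBZ // !form_deltas !diag0 mulr0 addr0 sub0r oppr_ge0 => le0.
  apply/eqP; rewrite -sqrf_eq0 eq_le sqr_ge0 andbT expr2; lra.
have Mi_gt0 : 0 < M i i by rewrite lt0r Mi_neq0 psdmx_diag_ge0.
have psdM' := psdmx_schur _ _ psdM Mi_gt0; set M' := (M - _) in psdM'.
have M'E j : M' j j = M j j - (M i i)^-1 * M i j ^+ 2.
  by rewrite !mxE big_ord1 !mxE expr2.
have lt_k : (#|[pred j | M' j j != 0%R]| < k)%N.
  rewrite -ltnS (leq_trans _ le_k) // ltnS; apply/proper_card/properP; split.
    (* A zero diagonal entry stays zero: subtracting a square can only lower it, and [M'] is still
       positive semidefinite. The entry at [i] becomes zero, so the inclusion is strict. *)
    apply/fintype.subsetP => j; rewrite !inE; apply: contra_neq => Mj0.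
    have := psdmx_diag_ge0 _ j psdM'; rewrite M'E Mj0 sub0r oppr_ge0 => le0.
    by apply/eqP; rewrite oppr_eq0 eq_le le0 mulr_ge0 ?sqr_ge0 // invr_ge0 ltW.
  by exists i; rewrite !inE // M'E negbK expr2 mulKf // subrr.
have [vs M'_sum] := IHk M' lt_k psdM'.
have ge0 : 0 <= (M i i)^-1 by rewrite invr_ge0 ltW.
exists ((Num.sqrt (M i i)^-1 *: row i M) :: vs).
rewrite big_cons -M'_sum -scalemxAr [(_ *: _)^T]linearZ/= -scalemxAl scalerA.
by rewrite -expr2 sqr_sqrtr // /M' addrC subrK.
Qed.

End PsdMatrices.
(** Take a subspace of maximal dimension inside [P]; adjoining a vector of [P] stays inside [P],
    hence cannot enlarge it. *)
Lemma submodule_vspace (K : fieldType) (V : vectType K) (P : V -> Prop) :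
  P 0 -> (forall a u v, P u -> P v -> P (a *: u + v)) ->
  exists W : {vspace V}, forall v, v \in W <-> P v.
Proof.
move=> P0 Plin.
pose dims (k : nat) := `[< exists2 W : {vspace V}, \dim W = k & forall v, v \in W -> P v >].
have dims0 : exists k, dims k.
  exists 0%N; apply/asboolP; exists 0%VS; rewrite ?dimv0 // => v.
  by rewrite memv0 => /eqP ->.
have dims_le k : dims k -> (k <= \dim {:V})%N.
  by move=> /asboolP[W <- _]; rewrite dimvS ?subvf.
case: (ex_maxnP dims0 dims_le) => k /asboolP[W dimW WP] kmax.
exists W => v; split=> [|Pv]; first exact: WP.
have /kmax : dims (\dim (W + <[v]>)).
  apply/asboolP; exists (W + <[v]>)%VS => // _ /memv_addP[w Ww [_ /vlineP[a ->] ->]].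
  by rewrite addrC; apply: Plin => //; exact: WP.
rewrite -dimW => le_dim.
have /eqP -> : W == (W + <[v]>)%VS by rewrite eqEdim addvSl.
by rewrite (subvP (addvSr W <[v]>)) ?memv_line.
Qed.

(** * Degree bounds and sums of squares *)

Section SumsOfSquares.
Context {R : realType} {n : nat}.
Implicit Types (p q : mpoly n R) (d : nat).

Lemma polys_le0 d : polys_le d (0 : mpoly n R).
Proof. by rewrite /polys_le/= mmeasure0. Qed.

Lemma polys_leC d (c : R) : polys_le d (mpolyC n c).
Proof. by rewrite /polys_le/= mmeasureC; case: eqP. Qed.

Lemma polys_leD d p q : polys_le d p -> polys_le d q -> polys_le d (p + q).
Proof.
by rewrite /polys_le/= => lep leq; rewrite (leq_trans (mmeasureD_le _ _ _)) // geq_max lep.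
Qed.

Lemma polys_leZ d (c : R) p : polys_le d p -> polys_le d (c *: p).
Proof. exact/leq_trans/mmeasureZ_le. Qed.

Lemma polys_le_sum d (I : Type) (s : seq I) (F : I -> mpoly n R) :
  (forall i, polys_le d (F i)) -> polys_le d (\sum_(i <- s) F i).
Proof.
by move=> leF; elim/big_ind: _ => // [|p q]; [exact: polys_le0|exact: polys_leD].
Qed.

Lemma evalp_sos_ge0 p (x : 'rV[R]_n) : sos p -> 0 <= evalp p x.
Proof.
move=> [qs ->]; rewrite /evalp raddf_sum/= sumr_ge0 // => q _.
by rewrite rmorphXn sqr_ge0.
Qed.

Lemma sosZ (c : R) p : 0 <= c -> sos p -> sos (c *: p).
Proof.
move=> c_ge0 [qs ->]; exists [seq Num.sqrt c *: q | q <- qs].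
by rewrite big_map scaler_sumr; apply: eq_bigr => q _; rewrite exprZn sqr_sqrtr.
Qed.

(* Squares of leading coefficients cannot cancel, so the square of the largest
   leading monomial survives in the sum. *)
Lemma polys_le_sum_sqr (d : nat) (qs : seq (mpoly n R)) :
  polys_le (2 * d) (\sum_(q <- qs) q ^+ 2) ->
  forall q, q \in qs -> polys_le d q.
Proof.
move=> le_sum q q_qs; rewrite /polys_le/=.
have [->|q_neq0] := eqVneq q 0; first by rewrite mmeasure0.
pose mu := (\join_(p <- qs | p != 0%R) mlead p)%O.
have le_mu p : p \in qs -> (mlead p <= mu)%O.
  move=> p_qs; have [->|p_neq0] := eqVneq p 0; first by rewrite mlead0 le0x.
  exact: joins_sup_seq.
have [p p_qs p_mu] : exists2 p, p \in qs & mcoeff mu p != 0.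
  rewrite /mu; case: bigjoinPcond => [||p p_neq0 p_qs]; first exact: le_total.
    by move=> /allP/(_ q q_qs); rewrite q_neq0.
  by exists p => //; rewrite mleadc_eq0.
(* No monomial in the list exceeds [mu], so only [mu] times [mu] contributes to this coefficient of
   a square. *)
have coef_mu : mcoeff (mnm_add mu mu) (\sum_(p <- qs) p ^+ 2) =
    \sum_(p <- qs) mcoeff mu p ^+ 2.
  rewrite raddf_sum/=; apply: eq_big_seq => r r_qs.
  by rewrite expr2 mleadcMW ?le_mu.
have : mnm_add mu mu \in msupp (\sum_(p <- qs) p ^+ 2).
  rewrite mcoeff_msupp coef_mu (big_rem p) //= gt_eqF //.
  rewrite ltr_wpDr ?sumr_ge0 // => [r _|]; first exact: sqr_ge0.
  by rewrite exprn_even_gt0.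
move=> /msize_mdeg_lt /leq_trans /(_ le_sum).
rewrite mdegD ltnS addnn -mul2n leq_pmul2l // => le_d.
by rewrite -(mlead_deg q_neq0) ltnS (leq_trans (lemc_mdeg (le_mu q q_qs))).
Qed.

End SumsOfSquares.

(** * Evaluation, minima and the union of point cones *)

Section Evaluation.
Context {R : realType} {n : nat}.
Implicit Types (p q f : mpoly n R) (x : 'rV[R]_n).

Lemma evalpBC f c x : evalp (f - mpolyC n c) x = evalp f x - c.
Proof. by rewrite /evalp mevalB mevalC. Qed.

Lemma continuous_evalp f : continuous (evalp f).
Proof.
have -> : evalp f = fun x : 'rV[R]_n => \sum_(m <- msupp f)
    (mcoeff m f * \prod_(i < n) x ord0 i ^+ m i).
  by apply/funext => x; rewrite /evalp mevalE.
apply: (@continuous_big R _ +%R 0 xpredT add_continuous 'rV[R]_n _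
  (fun m x => mcoeff m f * \prod_(i < n) x ord0 i ^+ m i)) => m _ x.
apply: continuousM; first exact: cst_continuous.
apply: (@continuous_big R _ *%R 1 xpredT mul_continuous 'rV[R]_n _
  (fun i x => x ord0 i ^+ m i)) => i _ {}x.
apply: (@continuous_comp _ _ _ (fun y : 'rV[R]_n => y ord0 i) (fun t => t ^+ m i)).
  exact: coord_continuous.
exact: exprn_continuous.
Qed.

Context {m : nat} (g : 'I_m -> mpoly n R).

Lemma evalp_gext_ge0 x (i : 'I_m.+1) : feasible g x -> 0 <= evalp (gext g i) x.
Proof.
move=> gx; rewrite /gext; case: unlift => [j|]; first exact: gx.
by rewrite /evalp meval1 ler01.
Qed.

Lemma evalp_quadmod_ge0 r d p x :
  quadmod g r d p -> feasible g x -> 0 <= evalp p x.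
Proof.
move=> [_ [s [sos_s _ ->]]] gx; rewrite /evalp raddf_sum/= sumr_ge0 // => i _.
by rewrite mevalM; apply: mulr_ge0; [exact: evalp_sos_ge0|exact: evalp_gext_ge0].
Qed.

(** A least value is unique, so [xget] returns it rather than the default. *)
Lemma minval_eq f x : feasible g x ->
  (forall y, feasible g y -> evalp f x <= evalp f y) -> minval g f = evalp f x.
Proof.
move=> gx fx_le; apply: xget_unique => [|v [[y gy <-] fy_le]].
  by split; [exact: imageP|move=> _ [y gy <-]; exact: fx_le].
by apply/eqP; rewrite eq_le fx_le // fy_le //; exact: imageP.
Qed.

Lemma exactness_cone_bigcup r d : feasible g !=set0 -> compact (feasible g) ->
  exactness_cone g r d = \bigcup_(x in feasible g) point_cone g x r d.
Proof.
move=> X_neq0 X_compact; apply/seteqP; split=> f /=.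
  move=> [f_le fv]; have [|x] := EVT_min_rV X_neq0 X_compact (f := evalp f).
    by apply: continuous_subspaceT; exact: continuous_evalp.
  rewrite inE => gx fx_le; exists x => //; split=> //.
  by rewrite -(minval_eq _ _ gx) // => y gy; rewrite fx_le ?inE.
move=> [x gx [f_le fx]]; split=> //.
rewrite (minval_eq _ _ gx) // => y gy.
by rewrite -subr_ge0 -evalpBC; exact: evalp_quadmod_ge0 fx gy.
Qed.

Lemma is_cone_point_cone x r d : is_cone (point_cone g x r d).
Proof.
move=> t f t_ge0 [f_le [fx_le [s [sos_s s_le fx_sum]]]].
have tE : t *: f - mpolyC n (evalp (t *: f) x) = t *: (f - mpolyC n (evalp f x)).
  by rewrite /evalp mevalZ scalerBr mpolyCM mul_mpolyC.
split; first exact: polys_leZ.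
rewrite tE; split; first exact: polys_leZ.
exists (fun i => t *: s i); split=> [i|i|]; first exact: sosZ.
  by rewrite -scalerAl; exact: polys_leZ.
by rewrite fx_sum scaler_sumr; apply: eq_bigr => i _; rewrite scalerAl.
Qed.

End Evaluation.

(** * Gram matrices of tuples of sums of squares *)

Section GramMatrices.
Context {R : realType} (n m r d : nat).
Local Notation poly := (mpoly n R).

(* The truncation sends all matrices to [polys_le d], as required of the
   projection in [semidefinite_representable]. *)
Definition mtrunc (p : poly) : poly :=
  \sum_(a : bmultinom n d.+1) mcoeff a p *: mpolyX R a.

Lemma mtrunc_is_linear : linear mtrunc.
Proof.
move=> c p q; rewrite /mtrunc scaler_sumr -big_split/=.
by apply: eq_bigr => a _; rewrite mcoeffD mcoeffZ scalerDl scalerA.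
Qed.

HB.instance Definition _ := GRing.isLinear.Build R poly poly *:%R mtrunc
  mtrunc_is_linear.

Lemma mtrunc_id p : polys_le d p -> mtrunc p = p.
Proof. by move=> p_le; rewrite [RHS](mpolywE p_le). Qed.

Lemma polys_le_mtrunc p : polys_le d (mtrunc p).
Proof.
apply: polys_le_sum => a; apply: polys_leZ.
by rewrite /polys_le/= mmeasureX bmdeg.
Qed.

(* The rows indexed by [inl (i, a)] hold a Gram matrix of the multiplier of
   [g_i]; the entry at [(inr true, inr false)] holds an arbitrary constant. *)
Definition gram_index : finType := ('I_m.+1 * bmultinom n r.+1 + bool)%type.
Local Notation N := #|gram_index|.
Local Notation pos i a := (enum_rank (inl (i, a) : gram_index)).

(** The [i]-th diagonal block as a quadratic form in the monomials of degree at most [r]. *)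
Definition gram_block (i : 'I_m.+1) (M : 'M[R]_N) : poly :=
  \sum_(a : bmultinom n r.+1) \sum_(b : bmultinom n r.+1)
    M (pos i a) (pos i b) *: (mpolyX R a * mpolyX R b).

(** An off-diagonal entry is used because diagonal ones cannot be negative. *)
Definition gram_const (M : 'M[R]_N) : R :=
  M (enum_rank (inr true : gram_index)) (enum_rank (inr false : gram_index)).

Definition row_block (i : 'I_m.+1) (v : 'rV[R]_N) : poly :=
  \sum_(a : bmultinom n r.+1) v ord0 (pos i a) *: mpolyX R a.

Lemma gram_block_is_linear i : linear (gram_block i).
Proof.
move=> c A B; rewrite /gram_block scaler_sumr -big_split/=.
apply: eq_bigr => a _; rewrite scaler_sumr -big_split/=.
by apply: eq_bigr => b _; rewrite !mxE scalerDl scalerA.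
Qed.

HB.instance Definition _ i := GRing.isLinear.Build R 'M[R]_N poly *:%R
  (gram_block i) (gram_block_is_linear i).

Lemma gram_const_is_linear : linear_for *%R gram_const.
Proof. by move=> c A B; rewrite /gram_const !mxE. Qed.

HB.instance Definition _ := GRing.isLinear.Build R 'M[R]_N R *%R gram_const
  gram_const_is_linear.

Lemma gram_block_rank1 i (v : 'rV[R]_N) :
  gram_block i (v^T *m v) = row_block i v ^+ 2.
Proof.
rewrite expr2 /row_block big_distrl/=; apply: eq_bigr => a _.
rewrite big_distrr/=; apply: eq_bigr => b _.
by rewrite !mxE big_ord1 !mxE -scalerAl -scalerAr scalerA.
Qed.

Lemma gram_block_psdmx_sos i (M : 'M[R]_N) : psdmx M -> sos (gram_block i M).
Proof.
move=> /psdmx_rank1_decomposition[vs ->]; exists [seq row_block i v | v <- vs].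
by rewrite raddf_sum big_map; apply: eq_bigr => v _; rewrite /= gram_block_rank1.
Qed.

Definition block_row (i : 'I_m.+1) (q : poly) : 'rV[R]_N :=
  \row_k if (enum_val k : gram_index) is inl (j, a) then mcoeff a q *+ (i == j) else 0.

(** Its rank-one square has the entry [c * 1] at the position read by [gram_const]. *)
Definition const_row (c : R) : 'rV[R]_N :=
  \row_k match (enum_val k : gram_index) with inl _ => 0 | inr b => if b then c else 1 end.

Lemma row_block_block_row i j q : polys_le r q ->
  row_block j (block_row i q) = q *+ (i == j).
Proof.
move=> q_le; rewrite [in RHS](mpolywE q_le) -sumrMnl; apply: eq_bigr => a _.
by rewrite mxE enum_rankK scalerMnl.
Qed.

Lemma row_block_const_row j c : row_block j (const_row c) = 0.
Proof. by rewrite /row_block big1 // => a _; rewrite mxE enum_rankK scale0r. Qed.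

(** Sum the rank-one squares of the coefficient rows and of one constant row. The rows of different
    blocks and the constant row have disjoint supports, so they do not interfere. *)
Lemma gram_matrix_exists (qs : 'I_m.+1 -> seq poly) (c : R) :
  (forall i q, q \in qs i -> polys_le r q) ->
  exists M : 'M[R]_N, [/\ psdmx M, gram_const M = c &
    forall j, gram_block j M = \sum_(q <- qs j) q ^+ 2].
Proof.
move=> qs_le.
pose vs := const_row c :: [seq block_row i q | i <- enum 'I_m.+1, q <- qs i].
exists (\sum_(v <- vs) v^T *m v); split; first exact: psdmx_sum_rank1.
  rewrite raddf_sum /vs big_cons /= big_allpairs_dep /=.
  rewrite big1 ?addr0 => [|i _]; last rewrite big1 // => q _.
    by rewrite /gram_const !mxE big_ord1 !mxE !enum_rankK mulr1.
  by rewrite /gram_const !mxE big_ord1 !mxE !enum_rankK mulr0.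
move=> j; rewrite raddf_sum /vs big_cons /= big_allpairs_dep /=.
rewrite gram_block_rank1 row_block_const_row expr0n add0r big_enum/=.
rewrite (bigD1 j) //= [X in _ + X]big1 ?addr0 => [|i i_neq_j].
  apply: eq_big_seq => q q_qs.
  by rewrite gram_block_rank1 row_block_block_row ?eqxx //; exact: qs_le q_qs.
apply: big1_seq => q /andP[_ q_qs]; rewrite gram_block_rank1.
by rewrite row_block_block_row ?(negbTE i_neq_j) ?expr0n //; exact: qs_le q_qs.
Qed.

End GramMatrices.

(** * Point cones as projections of spectrahedra *)

Section PointCone.
Context {R : realType} {n m : nat} (g : 'I_m -> mpoly n R) (r d : nat).
Local Notation N := #|gram_index n m r|.
Local Notation block i M := (gram_block n m r i M).

Definition gram_quadmod (M : 'M[R]_N) : mpoly n R :=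
  \sum_(i < m.+1) block i M * gext g i.

Lemma gram_quadmod_is_linear : linear gram_quadmod.
Proof.
move=> c A B; rewrite /gram_quadmod scaler_sumr -big_split/=.
by apply: eq_bigr => i _; rewrite linearP mulrDl scalerAl.
Qed.

HB.instance Definition _ := GRing.isLinear.Build R 'M[R]_N (mpoly n R) *:%R
  gram_quadmod gram_quadmod_is_linear.

Definition gram_proj (M : 'M[R]_N) : mpoly n R :=
  mtrunc n d (mpolyC n (gram_const n m r M) + gram_quadmod M).

Lemma gram_proj_is_linear : linear gram_proj.
Proof.
move=> c A B; rewrite /gram_proj -linearP; congr mtrunc.
by rewrite !linearP/= mpolyCD mpolyCM mul_mpolyC scalerDr addrACA.
Qed.

HB.instance Definition _ := GRing.isLinear.Build R 'M[R]_N (mpoly n R) *:%R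
  gram_proj gram_proj_is_linear.

(** The bound on the product bounds [s] only if [gext g i] is nonzero; otherwise [s] may have any
    degree and is replaced by the empty sum. *)
Lemma sos_gram_seq (i : 'I_m.+1) (s : mpoly n R) :
  sos s -> polys_le (2 * r) (s * gext g i) ->
  exists qs : seq (mpoly n R), (forall q, q \in qs -> polys_le r q) /\
    (\sum_(q <- qs) q ^+ 2) * gext g i = s * gext g i.
Proof.
move=> [qs s_sum]; have [->|g_neq0] := eqVneq (gext g i) 0.
  by exists [::]; rewrite !mulr0.
have [->|s_neq0] := eqVneq s 0.
  by exists [::]; rewrite big_nil !mul0r.
move=> sg_le; exists qs; rewrite -s_sum; split=> //.
apply: polys_le_sum_sqr; rewrite -s_sum; apply: leq_trans sg_le.
rewrite msizeM //; have : mmeasure mdeg (gext g i) != 0%N by rewrite msize_poly_eq0.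
by rewrite -lt0n; case: (mmeasure _ (gext g i)) => // k _; rewrite addnS leq_addr.
Qed.

Lemma semidefinite_representable_point_cone (x : 'rV[R]_n) :
  semidefinite_representable (@polys_le R n d) (point_cone g x r d).
Proof.
(* These conditions are homogeneous and linear, so the section needs no offset and [A = 0] serves
   below. *)
pose P (M : 'M[R]_N) := [/\ forall i, polys_le (2 * r) (block i M * gext g i),
  polys_le d (gram_quadmod M) & evalp (gram_quadmod M) x = 0].
have [W WP] : exists W : {vspace 'M[R]_N}, forall M, M \in W <-> P M.
  apply: submodule_vspace => [|c A B [Ai Ad Ax] [Bi Bd Bx]].
    by split=> [i||]; rewrite linear0 ?mul0r; [exact: polys_le0|exact: polys_le0|
      exact: meval0].
  split=> [i||]; rewrite linearP/=.
  - by rewrite mulrDl -scalerAl; apply: polys_leD => //; apply: polys_leZ; exact: Ai.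
  - by apply: polys_leD; [exact: polys_leZ|].
  - by move: Ax Bx; rewrite /evalp mevalD mevalZ => -> ->; rewrite mulr0 addr0.
exists N, [set M | psdmx M /\ M - 0 \in W], gram_proj; split.
- by exists 0, W.
- by move=> _ [M _ <-]; exact: polys_le_mtrunc.
apply/seteqP; split=> [f [f_le [fx_le [s [sos_s s_le fx_sum]]]]|].
  have /choice[qs qsP] i := sos_gram_seq i (s i) (sos_s i) (s_le i).
  have [M [psdM constM blockM]] :=
    gram_matrix_exists n m r qs (evalp f x) (fun i => (qsP i).1).
  have quadM : gram_quadmod M = f - mpolyC n (evalp f x).
    by rewrite fx_sum; apply: eq_bigr => i _; rewrite blockM (qsP i).2.
  exists M; last by rewrite /= /gram_proj constM quadM addrC subrK mtrunc_id.
  split=> //; rewrite subr0; apply/WP; split=> [i||].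
  - by rewrite blockM (qsP i).2.
  - by rewrite quadM.
  - by rewrite quadM evalpBC subrr.
move=> _ [M [psdM M_W] <-]; move: M_W; rewrite subr0 => /WP[block_le quad_le quad_x].
(* On the spectrahedron the degree is already at most [d], so truncation changes nothing. *)
have projE : gram_proj M = mpolyC n (gram_const n m r M) + gram_quadmod M.
  by rewrite /gram_proj mtrunc_id //; apply: polys_leD => //; exact: polys_leC.
rewrite -[_ M]/(gram_proj M) projE.
split; first by apply: polys_leD => //; exact: polys_leC.
(* Vanishing of the quadratic module part at [x] identifies the free constant with the value at
   [x]. *)
have -> : evalp (mpolyC n (gram_const n m r M) + gram_quadmod M) x = gram_const n m r M.
  by move: quad_x; rewrite /evalp mevalD mevalC => ->; rewrite addr0.
rewrite addrAC subrr add0r; split=> //; exists (fun i => block i M); split=> // i.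
exact: gram_block_psdmx_sos.
Qed.

End PointCone.

Theorem theorem1 (R : realType) (n m : nat) (g : 'I_m -> mpoly n R)
  (X_neq0 : feasible g !=set0) (X_compact : compact (feasible g))
  (rho : R) (rho_gt0 : 0 < rho)
  (X_ball : forall x : 'rV[R]_n, feasible g x ->
    \sum_(i < n) x ord0 i ^+ 2 <= rho ^+ 2)
  (X_arch : forall r : nat, (1 <= r)%N ->
    quadmod g r 2 (mpolyC n (rho ^+ 2) - sqnorm_poly R n)) :
  forall r d : nat, (1 <= r)%N ->
    exactness_cone g r d = \bigcup_(x in feasible g) point_cone g x r d /\
    (forall x : 'rV[R]_n, feasible g x ->
       is_cone (point_cone g x r d) /\
       semidefinite_representable (@polys_le R n d) (point_cone g x r d)).
Proof.
move=> r d _; split; first exact: exactness_cone_bigcup.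
move=> x _; split; first exact: is_cone_point_cone.
exact: semidefinite_representable_point_cone.
Qed.
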